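(* Let $\mathbb{K}$ be a field, $Q$ a monoid, $P$ a monoid of $\mathbb{K}$-algebra endomorphisms of $\mathbb{K}[Q]$, and let $\preceq$ be a $P$-order on $\mathbb{K}[Q]$. If $P$-divisibility $|_P$ is a well-partial-ordering on $Q$, then every $P$-invariant ideal $I\subseteq\mathbb{K}[Q]$ has a finite $P$-Gröbner basis with respect to $\preceq$. Moreover, if elements of $P$ send monomials to scalar multiples of monomials, the converse holds: if every $P$-invariant ideal $I\subseteq\mathbb{K}[Q]$ has a finite $P$-Gröbner basis with respect to $\preceq$, then $P$-divisibility $|_P$ is a well-partial-ordering on $Q$.
   Context: $Q$ is a possibly noncommutative monoid (semigroup with identity), and $\mathbb{K}[Q]$ is its semigroup ring over $\mathbb{K}$; elements of $Q$ are called monomials. $P$ is a monoid (under composition, containing the identity) of $\mathbb{K}$-algebra endomorphisms of $\mathbb{K}[Q]$. For $q\in Q$, $p\in P$, $f\in\mathbb{K}[Q]$, the expression $qp\cdot f$ (or $qpf$) means $q\cdot p(f)$. Given a total ordering $\preceq$ of $Q$, for nonzero $f\in\mathbb{K}[Q]$ let $\mathrm{in}_\prec(f)\in Q$ be the $\preceq$-largest monomial appearing in $f$ with nonzero coefficient; set $\mathrm{in}_\prec(0)=0$ and $0\prec q$ for all $q\in Q$. A well-ordering $\preceq$ of $Q$ is a $P$-order on $\mathbb{K}[Q]$ if for all $q\in Q$, $p\in P$, $f\in\mathbb{K}[Q]$: $\mathrm{in}_\prec(qp\cdot f)=\mathrm{in}_\prec(qp\cdot\mathrm{in}_\prec(f))$.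 $P$-divisibility: for $q_1,q_2\in Q$, $q_1\,|_P\,q_2$ if there exist $p\in P$ and $q\in Q$ with $q_2=q\cdot\mathrm{in}_\prec(pq_1)$. A left ideal $I\subseteq\mathbb{K}[Q]$ is $P$-invariant if $\{pn:p\in P,\ n\in I\}=I$. For $G\subseteq\mathbb{K}[Q]$ set $\mathrm{in}_\prec(G)=\{q\in Q:\mathrm{in}_\prec(g)\,|_P\,q\text{ for some }g\in G\setminus\{0\}\}$. A set $G\subseteq I$ is a $P$-Gröbner basis of a $P$-invariant ideal $I$ (with respect to $\preceq$) if $\mathrm{in}_\prec(I)=\mathrm{in}_\prec(G)$. A well-partial-ordering on a set is a partial order with no infinite antichains and no infinite strictly decreasing sequences. *)

(* Defs.v *)
From HB Require Import structures.
From mathcomp Require Import all_boot all_order all_algebra finmap.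
From mathcomp Require Import boolp classical_sets cardinality wochoice.
From mathcomp.multinomials Require Import monalg.

Set Implicit Arguments.
Unset Strict Implicit.
Unset Printing Implicit Defensive.

Import GRing.Theory.

Local Open Scope fset_scope.
Local Open Scope ring_scope.

(* The ring structure that [monalg] puts on [{malg K[Q]}] requires
   [Q : monomType], a structure with the extra axiom
   [x * y = 1 -> x = 1 /\ y = 1].  The alias [monring Q K] keeps the underlying
   vector space and carries the convolution product for every monoid [Q]. *)
Definition monring (Q : monoidType) (K : fieldType) : Type := {malg K[Q]}.

Section MonoidRing.
Variables (Q : monoidType) (K : fieldType).

HB.instance Definition _ := Choice.on (monring Q K).
HB.instance Definition _ := GRing.Lmodule.on (monring Q K).

Implicit Types (f g h : monring Q K) (q : Q).

Definition monring_one : monring Q K := << 1%g >>.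

Definition monring_mul f g : monring Q K :=
  \sum_(q1 <- msupp f) \sum_(q2 <- msupp g) << f@_q1 * g@_q2 *g (q1 * q2)%g >>.

Lemma monring_mulw (d1 d2 : {fset Q}) f g :
  msupp f `<=` d1 -> msupp g `<=` d2 ->
  monring_mul f g =
    \sum_(q1 <- d1) \sum_(q2 <- d2) << f@_q1 * g@_q2 *g (q1 * q2)%g >>.
Proof.
move=> le1 le2; rewrite /monring_mul (big_fset_incl _ le1) /=.
  apply/eq_bigr=> q1 _; apply/big_fset_incl => // q _ /mcoeff_outdom ->.
  by rewrite mulr0 monalgU0.
move=> q _ /mcoeff_outdom fq.
by rewrite big1 // => q' _; rewrite fq mul0r monalgU0.
Qed.

Lemma monring_mulUU (c1 c2 : K) q1 q2 :
  monring_mul << c1 *g q1 >> << c2 *g q2 >> = << c1 * c2 *g (q1 * q2)%g >>.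
Proof. by rewrite (monring_mulw msuppU_le msuppU_le) !big_seq_fset1 !mcoeffUU. Qed.

Lemma monring_mulDl : left_distributive monring_mul +%R.
Proof.
move=> f g h.
rewrite (monring_mulw (fsubsetUl (msupp f) (msupp g)) (fsubset_refl (msupp h))).
rewrite (monring_mulw (fsubsetUr (msupp f) (msupp g)) (fsubset_refl (msupp h))).
rewrite (monring_mulw (msuppD_le f g) (fsubset_refl (msupp h))).
rewrite -big_split /=; apply/eq_bigr=> q1 _.
rewrite -big_split /=; apply/eq_bigr=> q2 _.
by rewrite mcoeffD mulrDl monalgUD.
Qed.

Lemma monring_mulDr : right_distributive monring_mul +%R.
Proof.
move=> h f g.
rewrite (monring_mulw (fsubset_refl (msupp h)) (fsubsetUl (msupp f) (msupp g))).
rewrite (monring_mulw (fsubset_refl (msupp h)) (fsubsetUr (msupp f) (msupp g))).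
rewrite (monring_mulw (fsubset_refl (msupp h)) (msuppD_le f g)).
rewrite -big_split /=; apply/eq_bigr=> q1 _.
rewrite -big_split /=; apply/eq_bigr=> q2 _.
by rewrite mcoeffD mulrDr monalgUD.
Qed.

Lemma monring_mul0l : left_zero 0 monring_mul.
Proof. by move=> f; rewrite /monring_mul msupp0 big_seq_fset0. Qed.

Lemma monring_mul0r : right_zero 0 monring_mul.
Proof.
by move=> f; rewrite /monring_mul big1 // => q _; rewrite msupp0 big_seq_fset0.
Qed.

Lemma monring_ind (T : monring Q K -> Prop) :
    T 0 -> (forall f g, T f -> T g -> T (f + g)) ->
    (forall c q, T << c *g q >>) ->
  forall f, T f.
Proof. by move=> T0 TD TU f; rewrite [f]monalgE; apply: big_ind. Qed.

Lemma monring_mulA : associative monring_mul.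
Proof.
move=> f g h; elim/monring_ind: f => [|f f' IH IH'|a p].
- by rewrite !monring_mul0l.
- by rewrite !monring_mulDl IH IH'.
elim/monring_ind: g => [|g g' IH IH'|b q].
- by rewrite monring_mul0l monring_mul0r monring_mul0l.
- by rewrite monring_mulDl !monring_mulDr monring_mulDl IH IH'.
elim/monring_ind: h => [|h h' IH IH'|c r].
- by rewrite !monring_mul0r.
- by rewrite !monring_mulDr IH IH'.
by rewrite !monring_mulUU mulrA mulgA.
Qed.

Lemma monring_mul1l : left_id monring_one monring_mul.
Proof.
move=> f; elim/monring_ind: f => [|f g IHf IHg|c q].
- exact: monring_mul0r.
- by rewrite monring_mulDr IHf IHg.
by rewrite monring_mulUU mul1r mul1g.
Qed.

Lemma monring_mul1r : right_id monring_one monring_mul.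
Proof.
move=> f; elim/monring_ind: f => [|f g IHf IHg|c q].
- exact: monring_mul0l.
- by rewrite monring_mulDl IHf IHg.
by rewrite monring_mulUU mulr1 mulg1.
Qed.

Lemma monring_one_neq0 : monring_one != 0.
Proof. by rewrite monalgU_eq0 oner_eq0. Qed.

HB.instance Definition _ := GRing.Zmodule_isNzRing.Build (monring Q K)
  monring_mulA monring_mul1l monring_mul1r monring_mulDl monring_mulDr
  monring_one_neq0.

Lemma monring_mulE f g : f * g = monring_mul f g.
Proof. by []. Qed.

Lemma monring_scaleU (a c : K) q :
  a *: (<< c *g q >> : monring Q K) = << a * c *g q >>.
Proof. by apply/malgP=> k; rewrite mcoeffZ !mcoeffU mulrnAr. Qed.

Lemma monring_scaleAl (a : K) f g : a *: (f * g) = (a *: f) * g.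
Proof.
elim/monring_ind: f => [|f f' IH IH'|b p]; first by rewrite scaler0 !mul0r scaler0.
  by rewrite scalerDr !mulrDl scalerDr IH IH'.
elim/monring_ind: g => [|g g' IH IH'|c q]; first by rewrite !mulr0 scaler0.
  by rewrite !mulrDr scalerDr IH IH'.
by rewrite monring_scaleU !monring_mulE !monring_mulUU monring_scaleU mulrA.
Qed.

HB.instance Definition _ :=
  GRing.Lmodule_isLalgebra.Build K (monring Q K) monring_scaleAl.

Lemma monring_scaleAr (a : K) f g : a *: (f * g) = f * (a *: g).
Proof.
elim/monring_ind: f => [|f f' IH IH'|b p]; first by rewrite !mul0r scaler0.
  by rewrite !mulrDl scalerDr IH IH'.
elim/monring_ind: g => [|g g' IH IH'|c q]; first by rewrite scaler0 !mulr0 scaler0.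
  by rewrite scalerDr !mulrDr scalerDr IH IH'.
by rewrite monring_scaleU !monring_mulE !monring_mulUU monring_scaleU mulrCA.
Qed.

HB.instance Definition _ :=
  GRing.Lalgebra_isAlgebra.Build K (monring Q K) monring_scaleAr.

End MonoidRing.

Section Groebner.
Local Open Scope classical_set_scope.

Variables (Q : monoidType) (K : fieldType).
Local Notation A := (monring Q K).

Definition mon (q : Q) : A := << q >>.

(* [Q] together with a zero is encoded as [option Q], [None] standing for 0. *)
Definition omon (o : option Q) : A := oapp mon 0 o.

Definition endo_monoid (P : set {lrmorphism A -> A}) : Prop :=
  P idfun /\ forall p1 p2 : {lrmorphism A -> A}, P p1 -> P p2 -> P (p1 \o p2).

Variables (le : rel Q) (P : set {lrmorphism A -> A}).

Definition lead (f : A) : option Q :=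
  ohead [seq q <- msupp f | all (fun q' => le q' q) (msupp f)].

Definition P_order : Prop :=
  [/\ total_order le, well_order le &
      forall (q : Q) (p : {lrmorphism A -> A}) (f : A), P p ->
        lead (mon q * p f) = lead (mon q * p (omon (lead f)))].

(* The equation lives in the ring, so that it fails when [p (mon q1) = 0]. *)
Definition P_div (q1 q2 : Q) : bool :=
  `[< exists (p : {lrmorphism A -> A}) (q : Q),
        P p /\ mon q2 = mon q * omon (lead (p (mon q1))) >].

Definition left_ideal (I : set A) : Prop :=
  [/\ I 0, forall f g, I f -> I g -> I (f + g) & forall a f, I f -> I (a * f)].

Definition P_invariant (I : set A) : Prop :=
  [set (p : {lrmorphism A -> A}) n | p in P & n in I] = I.

Definition lead_set (G : set A) : set Q :=
  [set q | exists (g : A) (q0 : Q),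
     [/\ G g, g != 0, lead g = Some q0 & P_div q0 q]].

Definition P_groebner_basis (I G : set A) : Prop :=
  G `<=` I /\ lead_set I = lead_set G.

Definition finite_groebner_bases : Prop :=
  forall I : set A, left_ideal I -> P_invariant I ->
    exists2 G : set A, finite_set G & P_groebner_basis I G.

Definition monomial_up_to_scalars : Prop :=
  forall (p : {lrmorphism A -> A}) (q : Q), P p ->
    exists (c : K) (q' : Q), p (mon q) = c *: mon q'.

End Groebner.

Definition well_partial_order (T : eqType) (R : rel T) : Prop :=
  [/\ partial_order R,
      forall S : set T,
        (forall x y, S x -> S y -> R x y -> x = y) -> finite_set S &
      ~ exists u : nat -> T,
          forall n, R (u n.+1) (u n) /\ u n.+1 <> u n].

(* Main.v *)
From HB Require Import structures.
Require Import Defs.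
From mathcomp Require Import all_boot all_order all_algebra finmap.
From mathcomp Require Import boolp classical_sets cardinality wochoice.
From mathcomp.multinomials Require Import monalg.

(** From a well-partial-order to Groebner bases: the leading monomials of an
    invariant ideal form a set whose minimal elements for P-divisibility are an
    antichain, hence finitely many, and by well-foundedness every leading
    monomial is a P-multiple of one of them ([wpo_finite_basis]).  One element
    of the ideal for each minimal monomial gives the basis.

    Conversely, suppose that P sends monomials to scalar multiples of monomials.
    The key point is that P-divisibility is contained in the P-order
    ([P_div_le]).  Cancelling the leading term of a combination of two monomials
    shows that a linear map compatible with leading monomials, such as
    [f |-> q * p f], is strictly increasing on monomials wherever it does not
    kill them ([lead_stable_mono]).  For p the identity this makes left
    multiplication strictly increasing, and a strictly increasing self-map of a
    well-order never goes down, so 1 is the least monomial ([le1m]).  Hence no p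
    kills a monomial: if p q = 0 with q <> 1, then q + 1 has leading monomial q,
    and p (q + 1) = 1 would have the same leading monomial as p q = 0
    ([P_mon_neq0]).  So [f |-> q * p f] acts on monomials, up to scalars, as a
    strictly increasing self-map of Q, and every monomial lies below its image.
    Antisymmetry and the absence of infinite descent for P-divisibility are
    then inherited from the well-order.

    For an antichain S, the combinations of P-multiples of elements of S form a
    P-invariant left ideal that contains S.  Given a Groebner basis G, each s in
    S is P-divisible by the leading monomial of some g in G, which is itself a
    P-multiple of an element of S, necessarily s.  Thus s is the leading
    monomial of g, and S is finite when G is. *)

Set Implicit Arguments.
Unset Strict Implicit.
Unset Printing Implicit Defensive.

Import GRing.Theory.

Local Open Scope ring_scope.
Local Open Scope classical_set_scope.

(** * Well-partial-orders and well-orders *)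

(** Without such a minimal element, one could choose below every point of [S]
    a strictly smaller one, and iterating this choice from [x] would give an
    infinite descent. *)
Lemma wpo_minimal_below (T : eqType) (R : rel T) (S : set T) (x : T) :
    well_partial_order R -> S x ->
  exists m, [/\ S m, R m x & forall y, S y -> R y m -> y = m].
Proof.
move=> [[[Rxx Rtr] _] _ noDesc] Sx; apply: contrapT => noMin.
have /choice[f fP] (y : T) : exists z,
    S y /\ R y x -> [/\ S z /\ R z x, R z y & z <> y].
  case: (pselect (S y /\ R y x)) => [[Sy Ryx]|?]; last by exists y.
  apply: contrapT => noz; apply: noMin; exists y; split=> // z Sz Rzy.
  apply: contrapT => zy; apply: noz; exists z => _.
  by split=> //; split=> //; apply: Rtr Rzy Ryx.
apply: noDesc; exists (fun n => iter n f x) => n.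
have : S (iter n f x) /\ R (iter n f x) x.
  by elim: n => [|n /fP[]] //=; split.
by case/fP.
Qed.

(** The minimal elements of [S] form an antichain. *)
Lemma wpo_finite_basis (T : eqType) (R : rel T) (S : set T) :
    well_partial_order R ->
  exists M : set T, [/\ finite_set M, M `<=` S
    & forall x, S x -> exists2 m, M m & R m x].
Proof.
move=> Rwpo.
exists [set m | S m /\ forall y, S y -> R y m -> y = m]; split.
- case: (Rwpo) => _ fin _; apply: fin => x y [Sx _] [_ miny] Rxy.
  exact: miny.
- by move=> m [].
move=> x /(wpo_minimal_below Rwpo)[m [Sm Rmx minm]].
by exists m.
Qed.

(** If [s m < m] at the least such [m], then [s (s m) < s m] contradicts the
    choice of [m]. *)
Lemma strict_mono_ge (T : eqType) (le : rel T) (s : T -> T) (a : T) :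
    total_order le -> well_order le ->
    (forall x y, le x y -> x <> y -> le (s x) (s y) /\ s x <> s y) ->
  le a (s a).
Proof.
move=> [[_ anti] tot] wo smono; apply: contrapT => /negP aNle.
have [|m [[mD minm] _]] := wo [pred x | ~~ le x (s x)]; first by exists a.
have lesm : le (s m) m by have := tot m (s m); rewrite (negPf mD).
have smNm : s m <> m by move=> e; move: lesm mD; rewrite inE e => ->.
have [lessm ssmNsm] := smono _ _ lesm smNm.
have smD : ~~ le (s m) (s (s m)).
  by apply/negP => h; apply: ssmNsm; apply: anti; rewrite h lessm.
by move: mD; rewrite inE (minm _ smD).
Qed.

(** * Supports in the monoid ring *)

Section MonoidRing.
Variables (Q : monoidType) (K : fieldType).
Local Notation A := (monring Q K).
Local Notation mon := (@mon Q K).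

Lemma mcoeff_mon (a k : Q) : (mon a)@_k = (a == k)%:R.
Proof. exact: mcoeffU. Qed.

Lemma mem_msupp_scale_mon (c : K) (a k : Q) :
  (k \in msupp (c *: mon a)) = (c != 0) && (k == a).
Proof.
rewrite -mcoeff_neq0 mcoeffZ mcoeff_mon mulf_eq0 negb_or (eq_sym k a).
by case: (a == k); rewrite ?oner_eq0 ?eqxx.
Qed.

Lemma mem_msupp_mon (a k : Q) : (k \in msupp (mon a)) = (k == a).
Proof. by rewrite -[mon a]scale1r mem_msupp_scale_mon oner_eq0. Qed.

Lemma mon_inj : injective mon.
Proof.
by move=> a b ab; apply/eqP; rewrite -mem_msupp_mon -ab mem_msupp_mon.
Qed.

Lemma mon_neq0 a : mon a != 0.
Proof. by rewrite monalgU_eq0 oner_eq0. Qed.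

Lemma monM a b : mon a * mon b = mon (a * b)%g.
Proof. by rewrite monring_mulE monring_mulUU mulr1. Qed.

Lemma mon1 : mon 1%g = 1.
Proof. by []. Qed.

Lemma monring_mon_sum (f : A) : f = \sum_(q <- msupp f) f@_q *: mon q.
Proof.
rewrite {1}[f]monalgE; apply: eq_bigr => q _.
by rewrite monring_scaleU mulr1.
Qed.

(** Both factors of a product and the image under an endomorphism depend
    linearly on their arguments, so this one bound on supports covers left
    ideals and invariance. *)
Lemma mem_msupp_linear (phi : A -> A) (f : A) (k : Q) :
    linear phi -> k \in msupp (phi f) ->
  exists2 q, q \in msupp f & k \in msupp (phi (mon q)).
Proof.
move=> phiL; pose phi' : {linear A -> A} :=
  HB.pack phi (GRing.isLinear.Build _ _ _ _ phi phiL).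
move=> kf; apply: contrapT => noq; move: kf.
rewrite -mcoeff_neq0 -[phi f]/(phi' f) {1}[f]monring_mon_sum linear_sum raddf_sum.
rewrite big1_seq ?eqxx // => q /andP[_ qf]; rewrite linearZ /= mcoeffZ.
rewrite [_@_k]mcoeff_outdom ?mulr0 //.
by apply/negP => kq; apply: noq; exists q.
Qed.

Lemma mem_msuppM (f g : A) (k : Q) : k \in msupp (f * g) ->
  exists q1 q2, [/\ q1 \in msupp f, q2 \in msupp g & k = (q1 * q2)%g].
Proof.
move=> kfg.
have [|q2 q2g] := @mem_msupp_linear (fun h => f * h) g k _ kfg.
  by move=> c u v; rewrite mulrDr scalerAr.
move=> kfq.
have [|q1 q1f] := @mem_msupp_linear (fun h => h * mon q2) f k _ kfq.
  by move=> c u v; rewrite mulrDl scalerAl.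
by rewrite monM mem_msupp_mon => /eqP ->; exists q1, q2.
Qed.

End MonoidRing.

(** * Leading monomials *)

Section Lead.
Variables (Q : monoidType) (K : fieldType) (le : rel Q).
Local Notation A := (monring Q K).
Local Notation mon := (@mon Q K).
Hypothesis le_total : total_order le.

Lemma lead_SomeP (f : A) (q : Q) : lead le f = Some q <->
  q \in msupp f /\ forall k, k \in msupp f -> le k q.
Proof.
have [[_ anti] _] := le_total.
pose s := [seq q <- msupp f | all (fun q' => le q' q) (msupp f)].
have memP x : reflect (x \in msupp f /\ forall k, k \in msupp f -> le k x)
                (x \in s).
  by rewrite mem_filter andbC; apply: (iffP andP) => -[? /allP].
have ohead_mem x : ohead s = Some x -> x \in s.
  by case: (s) => //= y s' [->]; rewrite inE eqxx.
rewrite /lead -/s; split=> [/ohead_mem/memP//|[qf qmax]].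
have : q \in s by apply/memP.
case e: (ohead s) => [x|]; last by case: (s) e.
have /memP[xf xmax] := ohead_mem _ e.
by move=> _; congr Some; apply: anti; rewrite qmax ?xmax.
Qed.

Lemma lead0 : lead le (0 : A) = None.
Proof. by rewrite /lead msupp0. Qed.

Lemma lead_scale_mon (c : K) (q : Q) : c != 0 -> lead le (c *: mon q) = Some q.
Proof.
have [[[refl _] _] _] := le_total => c0.
apply/lead_SomeP; rewrite mem_msupp_scale_mon c0 eqxx; split=> // k.
by rewrite mem_msupp_scale_mon c0 => /eqP->.
Qed.

Lemma lead_mon (q : Q) : lead le (mon q) = Some q.
Proof. by rewrite -[mon q]scale1r lead_scale_mon ?oner_neq0. Qed.

Lemma lead_binomial (c d : K) (a b : Q) : c != 0 -> le a b -> a <> b ->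
  lead le (c *: mon b + d *: mon a) = Some b.
Proof.
have [[[refl _] _] _] := le_total => c0 leab ab; apply/lead_SomeP; split.
  rewrite -mcoeff_neq0 mcoeffD !mcoeffZ !mcoeff_mon eqxx.
  by case: (a =P b) => // _; rewrite mulr0 mulr1 addr0.
move=> k /(fsubsetP (msuppD_le _ _)); rewrite in_fsetU !mem_msupp_scale_mon.
by case/orP=> /andP[_ /eqP ->].
Qed.

Lemma lead_monB (a b : Q) :
  lead le (mon b - mon a) = Some b -> le a b /\ a <> b.
Proof.
have [->|/eqP ab] := eqVneq a b; first by rewrite subrr lead0.
case/lead_SomeP=> _ max; split=> //; apply: max.
rewrite -mcoeff_neq0 mcoeffB !mcoeff_mon eqxx.
by case: (b =P a) => [/esym//|_]; rewrite sub0r oppr_eq0 oner_eq0.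
Qed.

(** The scalars are chosen so that [phi] maps a combination of [mon a] and
    [mon b], with leading monomial [b], exactly to [mon b' - mon a'].  By
    stability [b'] leads this difference, so the difference is nonzero and [a']
    is the smaller of the two. *)
Lemma lead_stable_mono (phi : A -> A) (a b a' b' : Q) (c d : K) :
    linear phi -> (forall f, lead le (phi f) = lead le (phi (omon K (lead le f)))) ->
    c != 0 -> d != 0 -> phi (mon a) = c *: mon a' -> phi (mon b) = d *: mon b' ->
  le a b -> a <> b -> le a' b' /\ a' <> b'.
Proof.
move=> phiL; pose phi' : {linear A -> A} :=
  HB.pack phi (GRing.isLinear.Build _ _ _ _ phi phiL).
move=> stable c0 d0 phia phib leab ab; apply: lead_monB.
have -> : mon b' - mon a' = phi (d^-1 *: mon b + (- c^-1) *: mon a).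
  rewrite -[phi]/(phi' : A -> A) linearD !linearZ /= phia phib.
  by rewrite scaleNr !scalerA !mulVf // !scale1r.
by rewrite stable lead_binomial ?invr_eq0 //= phib lead_scale_mon.
Qed.

End Lead.

(** * Groebner bases from a well-partial-order *)

Lemma finite_groebner_bases_of_wpo (Q : monoidType) (K : fieldType) (le : rel Q)
    (P : set {lrmorphism monring Q K -> monring Q K}) :
  well_partial_order (P_div le P) -> finite_groebner_bases le P.
Proof.
move=> wpo I _ _; have [[[_ tr] _] _ _] := wpo.
pose leads := [set q | exists g, [/\ I g, g != 0 & lead le g = Some q]].
have [M [finM Mleads Mdiv]] := wpo_finite_basis leads wpo.
have /choice[g gP] (m : Q) : exists g, M m ->
    [/\ I g, g != 0 & lead le g = Some m].
  case: (pselect (M m)) => [/Mleads[g ?]|?]; last by exists 0.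
  by exists g.
exists (g @` M); first exact: finite_image.
have sGI : g @` M `<=` I by move=> _ [m /gP[Ig _ _] <-].
split=> //; apply/seteqP; split=> q [f [q0 [If f0 leadf div]]].
  have [|m Mm mq0] := Mdiv q0; first by exists f.
  have [_ gm0 leadgm] := gP m Mm.
  by exists (g m), m; split=> //; exact: tr mq0 div.
by exists f, q0; split=> //; apply: sGI.
Qed.

(** * P-divisibility under a P-order *)

Section POrder.
Variables (Q : monoidType) (K : fieldType) (le : rel Q).
Local Notation A := (monring Q K).
Local Notation mon := (@mon Q K).
Variable P : set {lrmorphism A -> A}.
Hypotheses (Pmon : endo_monoid P) (Ple : P_order le P).

Let le_total : total_order le. Proof. by case: Ple. Qed.

Lemma le_mul_mono (q a b : Q) : le a b -> a <> b ->
  le (q * a)%g (q * b)%g /\ (q * a)%g <> (q * b)%g.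
Proof.
have [P1 _] := Pmon; have [_ _ stable] := Ple.
apply: (@lead_stable_mono _ K le le_total (fun f => mon q * f) a b _ _ 1 1).
- by move=> c u v; rewrite mulrDr scalerAr.
- by move=> f; apply: (stable q idfun f P1).
- exact: oner_neq0.
- exact: oner_neq0.
- by rewrite monM scale1r.
- by rewrite monM scale1r.
Qed.

(** Left multiplication by [q] is strictly increasing, so [1 <= q * 1]. *)
Lemma le1m (q : Q) : le 1%g q.
Proof.
have [_ wo _] := Ple.
rewrite -[q in le _ q]mulg1.
by apply: (@strict_mono_ge _ le (fun a => q * a)%g) => // a b; apply: le_mul_mono.
Qed.

(** For [q <> 1], the leading monomial of [mon q + 1] is [q]; if [p] killed [mon q], it would
    have to kill [mon q + 1] as well, yet it maps this element to 1. *)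
Lemma P_mon_neq0 (p : {lrmorphism A -> A}) (q : Q) : P p -> p (mon q) != 0.
Proof.
move=> Pp; have [_ _ stable] := Ple.
have [->|/eqP q1] := eqVneq q 1%g; first by rewrite mon1 rmorph1 oner_neq0.
apply/eqP => pq0.
have := stable 1%g p (1 *: mon q + 1 *: mon 1%g) Pp.
rewrite lead_binomial ?oner_neq0 //; [|exact: le1m|by move=> e; case: q1].
by rewrite /= pq0 !scale1r rmorphD /= pq0 add0r rmorph1 mulr0 mulr1 lead0 lead_mon.
Qed.

Hypothesis Pscal : monomial_up_to_scalars P.

Lemma P_monE (p : {lrmorphism A -> A}) (q : Q) : P p ->
  exists (c : K) (q' : Q), c != 0 /\ p (mon q) = c *: mon q'.
Proof.
move=> Pp; have [c [q' pq]] := Pscal q Pp; exists c, q'; split=> //.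
by apply: contraNneq (P_mon_neq0 q Pp) => c0; rewrite pq c0 scale0r.
Qed.

(** Since leading monomials of images of monomials always exist, divisibility
    becomes an equation between monomials of [Q]. *)
Lemma P_divP (q1 q2 : Q) : P_div le P q1 q2 <->
  exists (p : {lrmorphism A -> A}) (q q' : Q) (c : K),
    [/\ P p, c != 0, p (mon q1) = c *: mon q' & q2 = (q * q')%g].
Proof.
split=> [/asboolP[p [q [Pp e]]]|[p [q [q' [c [Pp c0 pq1 ->]]]]]].
  have [c [q' [c0 pq1]]] := P_monE q1 Pp; exists p, q, q', c; split=> //.
  by move: e; rewrite pq1 lead_scale_mon //= monM => /mon_inj.
apply/asboolP; exists p, q; split=> //.
by rewrite pq1 lead_scale_mon //= monM.
Qed.

(** Up to nonzero scalars, [f |-> mon q * p f] acts on monomials as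
    [a |-> q * s a], a strictly increasing self-map of a well-order. *)
Lemma P_div_le (q1 q2 : Q) : P_div le P q1 q2 -> le q1 q2.
Proof.
have [_ wo stable] := Ple.
case/P_divP=> p [q [q' [c [Pp c0 pq1 ->]]]].
have /choice[s sP] (a : Q) : exists b, exists2 d : K,
    d != 0 & p (mon a) = d *: mon b.
  by have [d [b [d0 pa]]] := P_monE a Pp; exists b, d.
(* The monomial of [p (mon q1)] is unique, hence it is the chosen one. *)
have -> : q' = s q1.
  have [d d0 pq1'] := sP q1.
  by apply/eqP; have := mem_msupp_scale_mon d (s q1) q';
    rewrite -pq1' pq1 mem_msupp_scale_mon c0 d0 eqxx.
apply: (@strict_mono_ge _ le (fun a => q * s a)%g) => // a b.
have [[d d0 pa] [e e0 pb]] := (sP a, sP b).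
apply: (@lead_stable_mono _ K le le_total (fun f => mon q * p f) a b _ _ d e) => //.
- by move=> k u v; rewrite linearP mulrDr scalerAr.
- by move=> f; apply: stable.
- by rewrite pa -scalerAr monM.
- by rewrite pb -scalerAr monM.
Qed.

Lemma P_div_refl : reflexive (P_div le P).
Proof.
move=> q; apply/P_divP; have [P1 _] := Pmon.
by exists idfun, 1%g, q, 1; rewrite oner_neq0 scale1r mul1g.
Qed.

(** If [q2 = q * q'] with [q'] coming from [p q1], then [r q2] is [r q] times
    [r (p q1)] up to scalars, and the monomial of [r q] joins the left factor. *)
Lemma P_div_trans : transitive (P_div le P).
Proof.
move=> q2 q1 q3 /P_divP[p [q [q' [c [Pp c0 pq1 ->]]]]].
case/P_divP=> r [t [t' [d [Pr d0 rqq' ->]]]]; apply/P_divP.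
have [_ Pcomp] := Pmon.
have [e [u [e0 rq]]] := P_monE q Pr.
have [k [v [k0 rq']]] := P_monE q' Pr.
exists (r \o p), (t * u)%g, v, (c * k); split=> //.
- exact: Pcomp.
- by rewrite mulf_neq0.
- by rewrite /= pq1 linearZ /= rq' scalerA.
(* Expanding [r (mon (q * q'))] in two ways gives two scaled monomials, whose
   supports must agree. *)
have -> : t' = (u * v)%g; last by rewrite mulgA.
apply/eqP; have := mem_msupp_scale_mon d t' t'.
rewrite -rqq' -monM rmorphM /= rq rq' -scalerAl -scalerAr monM scalerA.
by rewrite mem_msupp_scale_mon mulf_neq0 //= d0 eqxx.
Qed.

Lemma P_div_partial_order : partial_order (P_div le P).
Proof.
split; first by split; [exact: P_div_refl|exact: P_div_trans].
have [[_ anti] _] := le_total.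
by move=> x y /andP[xy yx]; apply: anti; rewrite !P_div_le.
Qed.

Lemma P_div_no_descent : ~ exists u : nat -> Q,
  forall n, P_div le P (u n.+1) (u n) /\ u n.+1 <> u n.
Proof.
case=> u uP; have [_ wo _] := Ple; have [[_ anti] _] := le_total.
have [|m [[/asboolP[n _ <-] minu] _]] := wo [pred x | `[< range u x >]].
  by exists (u 0%N); apply/asboolP; exists 0%N.
have [div neq] := uP n; apply: neq; apply: anti; rewrite P_div_le //=.
by apply: minu; apply/asboolP; exists n.+1.
Qed.

(** The left ideal generated by all [p (mon s)]: in the monomial setting,
    membership can be read off the support. *)
Definition P_multiples (S : set Q) : set A :=
  [set f | forall q, q \in msupp f -> exists2 s, S s & P_div le P s q].

Lemma P_multiples_left_ideal (S : set Q) : left_ideal (P_multiples S).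
Proof.
split=> [q|f g If Ig q|a f If k]; first by rewrite msupp0.
  by move/(fsubsetP (msuppD_le _ _)); rewrite in_fsetU => /orP[/If|/Ig].
case/mem_msuppM=> q1 [q2 [_ /If[s Ss sq2] ->]]; exists s => //.
apply: P_div_trans sq2 _; apply/P_divP; have [P1 _] := Pmon.
by exists idfun, q1, q2, 1; rewrite oner_neq0 scale1r.
Qed.

Lemma P_multiples_invariant (S : set Q) : P_invariant P (P_multiples S).
Proof.
apply/seteqP; split=> [_ [p Pp [f If <-]] k|f If]; last first.
  by have [P1 _] := Pmon; exists idfun => //; exists f.
case/(mem_msupp_linear (linearP p)) => q /If[s Ss sq] kq; exists s => //.
apply: P_div_trans sq _; apply/P_divP.
have [c [q' [c0 pq]]] := P_monE q Pp.
exists p, 1%g, q', c; rewrite mul1g; split=> //.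
by move: kq; rewrite /= pq mem_msupp_scale_mon => /andP[_ /eqP].
Qed.

(** Taking leading monomials maps a finite Groebner basis of [P_multiples S]
    onto a set containing [S]. *)
Lemma P_div_antichain_finite (S : set Q) : finite_groebner_bases le P ->
  (forall x y, S x -> S y -> P_div le P x y -> x = y) -> finite_set S.
Proof.
move=> fgb anti.
have [_ antisym] := P_div_partial_order.
have [G finG [sGI leadGI]] :=
  fgb _ (P_multiples_left_ideal S) (P_multiples_invariant S).
(* The default 1 stands for the leading monomial of 0, and may only enlarge the
   image. *)
apply: (@sub_finite_set _ _ ((fun g => odflt 1%g (lead le g)) @` G));
  last exact: finite_image.
move=> s Ss; have : lead_set le P (P_multiples S) s.
  exists (mon s), s; split; rewrite ?mon_neq0 ?lead_mon ?P_div_refl //.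
  by move=> q; rewrite mem_msupp_mon => /eqP->; exists s; rewrite ?P_div_refl.
rewrite leadGI => -[g [q [Gg _ leadg qs]]]; exists g => //; rewrite leadg /=.
have /(lead_SomeP le_total)[qg _] := leadg.
have [s' Ss' s'q] := sGI g Gg q qg.
have ss' := anti _ _ Ss' Ss (P_div_trans s'q qs).
by apply: antisym; rewrite qs -ss' s'q.
Qed.

End POrder.

Theorem theorem2p12 (K : fieldType) (Q : monoidType)
    (P : set {lrmorphism monring Q K -> monring Q K}) (le : rel Q) :
  endo_monoid P ->
  P_order le P ->
  (well_partial_order (P_div le P) -> finite_groebner_bases le P) /\
  (monomial_up_to_scalars P -> finite_groebner_bases le P ->
     well_partial_order (P_div le P)).
Proof.
move=> Pmon Ple; split; first exact: finite_groebner_bases_of_wpo.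
move=> Pscal fgb; split.
- exact: P_div_partial_order.
- by move=> S; apply: P_div_antichain_finite.
- exact: P_div_no_descent.
Qed.
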